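(* Let $m,n$ be positive integers and let $\mathbf{h}=(h_1,\ldots,h_m)$ and $\mathbf{k}=(k_1,\ldots,k_n)$ be sequences of nonnegative integers. There exists a $\mathrm{NASM}(m,n;\mathbf{h},\mathbf{k})$ if and only if there exists a binary array $A\in\Phi(m,n;\mathbf{h},\mathbf{k})$ such that the graph $\Gamma(A)$ is bipartite.
   Context: The weight of a row (or column) of an integer matrix is the number of its nonzero entries. For an $m\times n$ matrix $A$, the row-weight sequence $w_r(A)$ is the sequence $(h_1,\ldots,h_m)$ where $h_i$ is the weight of row $i$, and the column-weight sequence $w_c(A)$ is the sequence $(k_1,\ldots,k_n)$ where $k_j$ is the weight of column $j$. $\Phi(m,n)$ is the set of all $m\times n$ arrays with entries in $\{0,1\}$ (binary arrays), and $\Psi(m,n)$ is the set of all $m\times n$ arrays with entries in $\{0,1,-1\}$. $\Phi(m,n;\mathbf{h},\mathbf{k})$ (respectively $\Psi(m,n;\mathbf{h},\mathbf{k})$) is the subset of those arrays $A$ with $w_r(A)=\mathbf{h}$ and $w_c(A)=\mathbf{k}$. An array $A\in\Psi(m,n)$ is a near alternating sign matrix (NASM) if in each row and in each column the nonzero entries alternate in sign (i.e. any two consecutive nonzero entries of a row or column, ignoring zeros, have opposite signs). A $\mathrm{NASM}(m,n;\mathbf{h},\mathbf{k})$ is a NASM belonging to $\Psi(m,n;\mathbf{h},\mathbf{k})$. For a binary array $A=(a_{ij})\in\Phi(m,n)$, $\Gamma(A)$ is the simple graph with vertex set $\{(i,j)\in\{1,\ldots,m\}\times\{1,\ldots,n\}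 : a_{ij}=1\}$, in which two vertices are adjacent if and only if the corresponding entries are consecutive nonzero entries of the same row or of the same column (they lie in the same row or the same column, and all entries of that row or column strictly between them are $0$). A graph is bipartite if it has a proper vertex-coloring with at most two colors. *)

(* Defs.v *)
From mathcomp Require Import all_boot all_order all_algebra.

Set Implicit Arguments.
Unset Strict Implicit.
Unset Printing Implicit Defensive.

Import Order.TTheory GRing.Theory Num.Theory.
Local Open Scope ring_scope.

Record sgraph := SGraph {
  vertex :> finType;
  adj : rel vertex;
  adj_sym : symmetric adj;
  adj_irrefl : irreflexive adj
}.

Definition proper_coloring (G : sgraph) (C : eqType) (c : G -> C) : Prop :=
  forall x y : G, adj x y -> c x != c y.

(* The colouring need not be surjective, so 'I_2 means "at most two colours". *)
Definition bipartite (G : sgraph) : Prop :=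
  exists c : G -> 'I_2, proper_coloring c.

Definition weight (n : nat) (f : 'I_n -> int) : nat := #|[set j | f j != 0]|.

Definition row_weights (m n : nat) (A : 'M[int]_(m, n)) : m.-tuple nat :=
  [tuple weight (fun j => A i j) | i < m].

Definition col_weights (m n : nat) (A : 'M[int]_(m, n)) : n.-tuple nat :=
  [tuple weight (fun i => A i j) | j < n].

Definition Phi (m n : nat) : pred 'M[int]_(m, n) :=
  fun A => [forall i, forall j, A i j \in [:: 0; 1]].

Definition Psi (m n : nat) : pred 'M[int]_(m, n) :=
  fun A => [forall i, forall j, A i j \in [:: 0; 1; -1]].

Definition Phi_weights (m n : nat) (h : m.-tuple nat) (k : n.-tuple nat) :
    pred 'M[int]_(m, n) :=
  fun A => [&& A \in @Phi m n, row_weights A == h & col_weights A == k].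

Definition Psi_weights (m n : nat) (h : m.-tuple nat) (k : n.-tuple nat) :
    pred 'M[int]_(m, n) :=
  fun A => [&& A \in @Psi m n, row_weights A == h & col_weights A == k].

(* Ordered: a comes strictly before b in the line f. *)
Definition consecutive (n : nat) (f : 'I_n -> int) (a b : 'I_n) : bool :=
  [&& (a < b)%N, f a != 0, f b != 0
    & [forall c : 'I_n, (a < c < b)%N ==> (f c == 0)]].

Definition alternating (n : nat) (f : 'I_n -> int) : Prop :=
  forall a b : 'I_n, consecutive f a b -> Num.sg (f a) = - Num.sg (f b).

Definition is_nasm (m n : nat) (A : 'M[int]_(m, n)) : Prop :=
  [/\ A \in @Psi m n,
      forall i : 'I_m, alternating (fun j => A i j)
    & forall j : 'I_n, alternating (fun i => A i j)].

Definition is_nasm_weights (m n : nat) (h : m.-tuple nat) (k : n.-tuple nat)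
    (A : 'M[int]_(m, n)) : Prop :=
  is_nasm A /\ A \in Psi_weights h k.

Section Gamma.

Variables (m n : nat) (A : 'M[int]_(m, n)).

Definition Gamma_vertex : finType := {p : 'I_m * 'I_n | A p.1 p.2 == 1}.

Definition Gamma_adj : rel Gamma_vertex := fun u v =>
  let: (i, j) := val u in
  let: (i', j') := val v in
  (i == i') && (consecutive (fun l => A i l) j j'
                || consecutive (fun l => A i l) j' j)
  || (j == j') && (consecutive (fun l => A l j) i i'
                   || consecutive (fun l => A l j) i' i).

Lemma Gamma_adj_sym : symmetric Gamma_adj.
Proof.
move=> [[i j] p] [[i' j'] q]; rewrite /Gamma_adj /=.
by congr (_ || _); rewrite eq_sym; case: eqP => //= <-; rewrite orbC.
Qed.

Lemma Gamma_adj_irrefl : irreflexive Gamma_adj.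
Proof. by move=> [[i j] p]; rewrite /Gamma_adj /consecutive /= !ltnn !andbF. Qed.

Definition Gamma : sgraph := SGraph Gamma_adj_sym Gamma_adj_irrefl.

End Gamma.

(* Main.v *)
(* Weights and consecutiveness depend only on the support, so a NASM and a
   binary array correspond to each other through a common support; the sign of
   the NASM entry is then a 2-colouring of the vertices, and alternation of the
   signs is exactly properness of this colouring. *)

Require Import Defs.
From mathcomp Require Import all_boot all_order all_algebra.

Set Implicit Arguments.
Unset Strict Implicit.
Unset Printing Implicit Defensive.

Import Order.TTheory GRing.Theory Num.Theory.
Local Open Scope ring_scope.

Lemma eq_supp_weight n (f g : 'I_n -> int) :
  (forall j, (f j == 0) = (g j == 0)) -> weight f = weight g.
Proof.
by move=> fg; rewrite /weight; apply: eq_card => j; rewrite !inE fg.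
Qed.

Lemma eq_supp_consecutive n (f g : 'I_n -> int) :
  (forall j, (f j == 0) = (g j == 0)) -> consecutive f =2 consecutive g.
Proof.
move=> fg a b; rewrite /consecutive !fg; congr [&& _, _, _ & _].
by apply: eq_forallb => c; rewrite fg.
Qed.

Lemma eq_supp_row_weights m n (A B : 'M[int]_(m, n)) :
  (forall i j, (A i j == 0) = (B i j == 0)) -> row_weights A = row_weights B.
Proof.
move=> AB; apply: eq_from_tnth => i; rewrite !tnth_mktuple.
exact: eq_supp_weight.
Qed.

Lemma eq_supp_col_weights m n (A B : 'M[int]_(m, n)) :
  (forall i j, (A i j == 0) = (B i j == 0)) -> col_weights A = col_weights B.
Proof.
move=> AB; apply: eq_from_tnth => j; rewrite !tnth_mktuple.
exact: eq_supp_weight.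
Qed.

Lemma PhiP m n (A : 'M[int]_(m, n)) :
  reflect (forall i j, A i j \in [:: 0; 1]) (A \in @Phi m n).
Proof. exact: 'forall_forallP. Qed.

Lemma PsiP m n (A : 'M[int]_(m, n)) :
  reflect (forall i j, A i j \in [:: 0; 1; -1]) (A \in @Psi m n).
Proof. exact: 'forall_forallP. Qed.

Lemma norm_mx_supp m n (A : 'M[int]_(m, n)) i j :
  (map_mx Num.norm A i j == 0) = (A i j == 0).
Proof. by rewrite mxE normr_eq0. Qed.

(** Absolute values forget the signs of [A] but not its support, so the forgotten signs can colour
    the vertices. *)
Lemma nasm_bipartite m n (A : 'M[int]_(m, n)) :
  is_nasm A -> bipartite (Gamma (map_mx Num.norm A)).
Proof.
case=> /PsiP Apsi Arow Acol.
have supp := norm_mx_supp A.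
(* [A i j != 0] excludes two zero entries, which also satisfy the sign equation. *)
have sgA i j i' j' : A i j != 0 -> Num.sg (A i j) = - Num.sg (A i' j') ->
    (A i j == 1) != (A i' j' == 1).
  by move: (Apsi i j) (Apsi i' j'); rewrite !inE => /or3P[]/eqP-> /or3P[]/eqP->.
(* Alternation concerns ordered pairs while edges are unordered; having opposite signs is symmetric,
   which bridges the two. *)
have altA (l : nat) (f : 'I_l -> int) : alternating f -> forall a b,
    consecutive f a b || consecutive f b a ->
    f a != 0 /\ Num.sg (f a) = - Num.sg (f b).
  move=> altf a b /orP[] ab; have [_ fa fb _] := and4P ab.
    by split=> //; apply: altf.
  by split=> //; rewrite (altf _ _ ab) opprK.
exists (fun u => if A (val u).1 (val u).2 == 1 then ord0 else ord_max).
move=> [[i j] p] [[i' j'] q] /=; rewrite /Gamma_adj /=.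
move=> adj_uv; suff: (A i j == 1) != (A i' j' == 1).
  by case: (A i j == 1); case: (A i' j' == 1).
case/orP: adj_uv => /andP[/eqP eq_line].
  subst i'; rewrite !(@eq_supp_consecutive n _ (fun l => A i l)) //.
  by case/(altA _ _ (Arow i)) => *; apply: sgA.
subst j'; rewrite !(@eq_supp_consecutive m _ (fun l => A l j)) //.
by case/(altA _ _ (Acol j)) => *; apply: sgA.
Qed.

(** Each 1 of [A] receives a sign dictated by its colour. Agreement of supports is recorded because
    it carries the weights over. *)
Lemma bipartite_nasm m n (A : 'M[int]_(m, n)) :
  A \in @Phi m n -> bipartite (Gamma A) ->
  exists2 B : 'M[int]_(m, n), is_nasm B &
    forall i j, (B i j == 0) = (A i j == 0).
Proof.
move=> /PhiP Aphi [c c_proper].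
have A1 i j : A i j != 0 -> A i j == 1.
  by move: (Aphi i j); rewrite !inE => /orP[]/eqP->.
(* [c] is defined on vertices only, so [insub] tests whether [(i, j)] is one; all other positions
   get 0. *)
pose B : 'M[int]_(m, n) := \matrix_(i, j)
  if insub (i, j) is Some u then (-1) ^+ (c (u : Gamma_vertex A) == ord0) else 0.
have BE i j (p : A i j == 1) : B i j = (-1) ^+ (c (Sub (i, j) p) == ord0).
  by rewrite mxE insubT.
have supp i j : (B i j == 0) = (A i j == 0).
  have [Aij0|/A1 p] := eqVneq (A i j) 0; last by rewrite (BE _ _ p) signr_eq0.
  by rewrite mxE insubF /= ?Aij0 ?eqxx.
(* With only two colours, exactly one of two distinct colours is [ord0], so the signs are
   opposite. *)
have c2 (x y : 'I_2) : x != y ->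
    Num.sg ((-1) ^+ (x == ord0)) = - Num.sg ((-1) ^+ (y == ord0)) :> int.
  by case: x y => [[|[|//]] ?] [[|[|//]] ?].
exists B => //; split.
- apply/PsiP => i j; have [Aij0|/A1 p] := eqVneq (A i j) 0.
    by move: (supp i j); rewrite Aij0 eqxx inE => ->.
  by rewrite (BE _ _ p); case: eqP.
(* Equal supports make entries consecutive in [B] consecutive in [A], hence adjacent in [Gamma A]
   and differently coloured. *)
- move=> i a b; rewrite (@eq_supp_consecutive n _ (fun l => A i l)) // => ab.
  have [_ /A1 pa /A1 pb _] := and4P ab.
  rewrite (BE _ _ pa) (BE _ _ pb); apply/c2/c_proper.
  by rewrite /= /Gamma_adj /= eqxx ab.
- move=> j a b; rewrite (@eq_supp_consecutive m _ (fun l => A l j)) // => ab.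
  have [_ /A1 pa /A1 pb _] := and4P ab.
  rewrite (BE _ _ pa) (BE _ _ pb); apply/c2/c_proper.
  by rewrite /= /Gamma_adj /= eqxx ab orbT.
Qed.

Theorem theorem2p3 (m n : nat) (hm : (0 < m)%N) (hn : (0 < n)%N)
    (h : m.-tuple nat) (k : n.-tuple nat) :
  (exists A : 'M[int]_(m, n), is_nasm_weights h k A) <->
  (exists2 A : 'M[int]_(m, n), A \in Phi_weights h k & bipartite (Gamma A)).
Proof.
split=> [[A [nasmA /and3P[/PsiP Apsi rA cA]]]|[A /and3P[Aphi rA cA] bipA]].
  have supp := norm_mx_supp A.
  (* Absolute values send 0, 1, -1 into 0, 1 and preserve both weight sequences. *)
  exists (map_mx Num.norm A); last exact: nasm_bipartite.
  apply/and3P; split.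
  - apply/PhiP => i j; rewrite mxE; move: (Apsi i j).
    by rewrite !inE => /or3P[]/eqP->.
  - by rewrite (eq_supp_row_weights supp).
  - by rewrite (eq_supp_col_weights supp).
have [B nasmB supp] := bipartite_nasm Aphi bipA.
exists B; split=> //; apply/and3P; split; first by case: nasmB.
  by rewrite (eq_supp_row_weights supp).
by rewrite (eq_supp_col_weights supp).
Qed.
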